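(* Let $(T,d,\rho)$ be a rooted compact real tree and let $\leq_{\mathrm{Sh}}$ be the random uniform shuffling of $T$ (defined in the context). Almost surely, any finite Borel measure $\mu$ on $T$ whose topological support is $T$ satisfies (Mes) with respect to $\leq_{\mathrm{Sh}}$.
   Context: A real tree is a metric space $(T,d)$ in which any two points $\sigma,\sigma'$ are joined by a path isometric to $[0,d(\sigma,\sigma')]$, with image denoted $[\![\sigma,\sigma']\!]$, and such that every continuous injective $q:[0,1]\to T$ has image $[\![q(0),q(1)]\!]$. It is rooted if a point $\rho\in T$ is distinguished. The point $\sigma\wedge\sigma'$ is defined by $[\![\rho,\sigma\wedge\sigma']\!]=[\![\rho,\sigma]\!]\cap[\![\rho,\sigma']\!]$. $\mathrm{Br}(T)$ is the set (at most countable when $T$ is compact) of $\sigma\in T\setminus\{\rho\}$ such that $T\setminus\{\sigma\}$ has at least $3$ connected components. (Mes), for a linear order $\leq$ on $T$ and a measure $\mu$: for all distinct $\sigma_1,\sigma_2\in T$ with $\sigma_1<\sigma_2$, $\mu(\{\sigma\in T:\sigma_1<\sigma<\sigma_2\})>0$. For $\sigma\in T$, let $\mathcal{C}_\sigma$ be the (at most countable) set of connected components of $T\setminus\{\sigma\}$ that do not contain $\rho$. Fix an index set $I_\sigma$ equal to $\emptyset$, $\{1,\dots,n\}$ or $\{1,2,\dots\}$, and a bijection $k\mapsto C_\sigma(k)$ from $I_\sigma$ onto $\mathcal{C}_\sigma$. Given linear orders $\mathbf{O}=\{\lhd_\sigma,\ \sigma\in\mathrm{Br}(T)\cup\{\rho\}\}$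 on the sets $I_\sigma$, the (reflexive) relation $\lhd_{\mathbf{O}}$ on $T$ is defined for distinct $\sigma,\sigma'$ by: if $\sigma\wedge\sigma'\in\{\sigma,\sigma'\}$, then $\sigma\lhd_{\mathbf{O}}\sigma'$ if $\sigma\in[\![\rho,\sigma']\!]$ and $\sigma'\lhd_{\mathbf{O}}\sigma$ if $\sigma'\in[\![\rho,\sigma]\!]$; otherwise $\sigma\wedge\sigma'\in\mathrm{Br}(T)\cup\{\rho\}$, there are distinct $k,k'\in I_{\sigma\wedge\sigma'}$ with $\sigma\in C_{\sigma\wedge\sigma'}(k)$, $\sigma'\in C_{\sigma\wedge\sigma'}(k')$, and $\sigma\lhd_{\mathbf{O}}\sigma'$ if $k\lhd_{\sigma\wedge\sigma'}k'$, $\sigma'\lhd_{\mathbf{O}}\sigma$ if $k'\lhd_{\sigma\wedge\sigma'}k$. This is a linear order on $T$. **Random uniform shuffling.** On a probability space $(\Omega,\mathcal{F},\mathbb{P})$ let $\{U_{\sigma,k}:\sigma\in\mathrm{Br}(T)\cup\{\rho\},\ k\in I_\sigma\}$ be a (countable) family of i.i.d. random variables uniformly distributed on $[0,1]$. Define (almost surely) linear orders $\lhd_\sigma$ on $I_\sigma$ by $k\lhd_\sigma l$ iff $U_{\sigma,k}\leq U_{\sigma,l}$, let $\mathbf{O}=\{\lhd_\sigma\}$ and set $\leq_{\mathrm{Sh}}\,=\,\lhd_{\mathbf{O}}$. ''Almost surely, any $\mu$...'' means that there is a single $\mathbb{P}$-null event, not depending on $\mu$, outside of which the property holds for all such $\mu$.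 *)

(* Defs.v *)
From HB Require Import structures.
From mathcomp Require Import all_boot all_order all_algebra finmap.
From mathcomp Require Import all_classical all_reals all_analysis.

Set Implicit Arguments.
Unset Strict Implicit.
Unset Printing Implicit Defensive.

Import Order.TTheory GRing.Theory Num.Theory.
Import numFieldNormedType.Exports.

Local Open Scope classical_set_scope.
Local Open Scope ring_scope.

(* Measurable types are pointed in MathComp-Analysis: the root of [T] serves as
   the distinguished point of the carrier of the Borel sigma-algebra. *)
Definition rooted (R : realType) (T : metricType R) (rho : T) : Type := T.

HB.instance Definition _ (R : realType) (T : metricType R) (rho : T) :=
  Metric.copy (rooted rho) T.
HB.instance Definition _ (R : realType) (T : metricType R) (rho : T) :=
  isPointed.Build (rooted rho) rho.

Definition borel (R : realType) (T : metricType R) (rho : T) :=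
  g_sigma_algebraType (@open (rooted rho)).

Section real_tree.
Context {R : realType} {T : metricType R}.
Implicit Types (x y z rho : T).

Definition geodesic x y (f : R -> T) : Prop :=
  [/\ f 0 = x, f (mdist x y) = y &
    {in `[0, mdist x y] &, forall s t, mdist (f s) (f t) = `|s - t|}].

(* The union of the images of all geodesics from [x] to [y]; in a real tree all
   these images coincide, so this is the image of any one of them. *)
Definition segment x y : set T :=
  [set z | exists2 f, geodesic x y f & (f @` `[0, mdist x y]) z].

Definition real_tree : Prop :=
  (forall x y, exists f, geodesic x y f) /\
  (forall q : R -> T, {within `[0, 1], continuous q} -> set_inj `[0, 1] q ->
    q @` `[0, 1] = segment (q 0) (q 1)).

Definition branch_meet rho x y : T :=
  xget rho [set z | segment rho z = segment rho x `&` segment rho y].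

Definition components (A : set T) : set (set T) := connected_component A @` A.

Definition Br rho : set T :=
  [set x | x <> rho /\ (`I_3 #<= components (~` [set x]))%card].

(* The set written C_sigma in the mathematics. *)
Definition upper_components rho x : set (set T) :=
  [set A | components (~` [set x]) A /\ ~ A rho].

Definition component_enumeration rho (I : T -> set nat)
    (C : T -> nat -> set T) : Prop :=
  forall x,
    ((exists n, I x = [set k | (1 <= k <= n)%N]) \/ I x = [set k | (1 <= k)%N])
    /\ set_bij (I x) (upper_components rho x) (C x).

(* The relation associated with a family [O] of orders on the sets [I x]. *)
Definition tree_order rho (I : T -> set nat) (C : T -> nat -> set T)
    (O : T -> nat -> nat -> Prop) x y : Prop :=
  let z := branch_meet rho x y in
  [\/ x = y,
      (z = x \/ z = y) /\ segment rho y x |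
      [/\ z <> x, z <> y & exists k l,
        [/\ I z k /\ I z l, k <> l, C z k x, C z l y & O z k l]]].

Definition shuffle_index rho (I : T -> set nat) : set (T * nat) :=
  [set p | (Br rho p.1 \/ p.1 = rho) /\ I p.1 p.2].

Definition lt_of (le : T -> T -> Prop) x y : Prop := le x y /\ x <> y.

Definition msupport rho (mu : {measure set (borel rho) -> \bar R}) : set T :=
  [set x | forall U : set T, open U -> U x -> (0 < mu U)%E].

Definition Mes rho (le : T -> T -> Prop)
    (mu : {measure set (borel rho) -> \bar R}) : Prop :=
  forall x1 x2, lt_of le x1 x2 ->
    (0 < mu [set x | lt_of le x1 x /\ lt_of le x x2])%E.

End real_tree.

Section iid.
Context {d : measure_display} {Omega : measurableType d} {R : realType}.
Variable P : probability Omega R.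

Definition mutually_independent (J : choiceType) (D : set J)
    (X : J -> {RV P >-> R}) : Prop :=
  forall (F : {fset J}) (A : J -> set R),
    (forall j, j \in F -> D j /\ measurable (A j)) ->
    P (\bigcap_(j in [set` F]) (X j @^-1` A j)) =
      (\prod_(j <- F) P (X j @^-1` A j))%E.

Definition iid_uniform01 (J : choiceType) (D : set J)
    (X : J -> {RV P >-> R}) : Prop :=
  mutually_independent D X /\
  forall j, D j -> forall A : set R, measurable A ->
    distribution P (X j) A = uniform_prob (@ltr01 R) A.

(* Only the variables [U (x, k)] with [(x, k)] in [shuffle_index rho I] are read
   by [tree_order] when [T] is a real tree. *)
Definition shuffle_order {T : metricType R} (rho : T) (I : T -> set nat)
    (C : T -> nat -> set T) (U : T * nat -> {RV P >-> R}) (w : Omega) :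
    T -> T -> Prop :=
  tree_order rho I C (fun x k l => U (x, k) w <= U (x, l) w).

End iid.

(* Main.v *)
Require Import Defs.
From HB Require Import structures.
From mathcomp Require Import all_boot all_order all_algebra finmap.
From mathcomp Require Import all_classical all_reals all_analysis.
From mathcomp Require Import lra.

Set Implicit Arguments.
Unset Strict Implicit.
Unset Printing Implicit Defensive.

Import Order.TTheory GRing.Theory Num.Theory.
Import numFieldNormedType.Exports.

Local Open Scope classical_set_scope.
Local Open Scope ring_scope.

(** Why the theorem holds. For a measure of full support it is enough that every
    interval [{v | x < v < y}] of the shuffled order is Borel and contains a
    nonempty open set. Both are statements about the order alone, so one null
    event serves all measures.

    Borel: the points above [x] form an open set, being the union of the
    descendants of [x] and of whole components hanging from the branch
    [[rho, x]]. The points below [y] are the segment [[rho, y]] without [y]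
    (closed minus closed), together with a union of components, which is open
    ([measurable_interval]).

    Nonempty interior: if [x] is not an ancestor of [y], replace it by a point
    strictly between the meet of [x] and [y] and the point [y]: everything above
    that point is above [x] ([lt_interval]). So let [x] be an ancestor of [y].
    If some piece of [[x, y]] carries no branch point, then the interior of that
    piece is open in the tree ([branch_free_interval]). Otherwise branch points
    are dense in [[x, y]], and a single branch point [p] strictly between [x]
    and [y] with a component preceding the one of [y] is sufficient, since that
    component is open and lies inside the interval ([dense_interval]).

    Probability enters only to produce such a [p]. When branch points are dense
    between [x] and [y], there is an infinite sequence of them, and at the n-th
    one two components, the one of [y] and another one, are compared by two
    fresh independent uniform variables. With probability at least 1/4 they are
    separated by 1/2 in the favourable direction, so almost surely this happens
    for some n ([negligible_never_le]). One may choose [x] and [y] to be branch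
    points themselves, and there are countably many of those
    ([countable_Br]); this makes the null event independent of [x] and [y].

    The geometry is derived from betweenness, [d x p + d p y = d x y]. The two
    axioms of real trees are used through three consequences: a point between
    [x] and [y] is determined by its distance to [x] ([btw_uniq]), any three
    points have a median ([median]), and the components of the complement of [s]
    are the classes of the relation [s] is not between [x] and [y]
    ([connected_component_side]). *)

(** * Metric consequences of the real tree axioms *)

Lemma open_of_open_subsets (S : topologicalType) (A : set S) :
  (forall x, A x -> exists V, [/\ open V, V x & V `<=` A]) -> open A.
Proof.
move=> h; rewrite openE => x /h[V [oV Vx VA]].
by rewrite /interior nbhsE; exists V.
Qed.

Section betweenness.
Context {R : realType} {T : metricType R}.
Implicit Types (x y z p q : T).

(** Membership of [p] in the segment from [x] to [y], see [segmentE]; the form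
    [btw rho x y] says that [x] is an ancestor of [y]. *)
Definition btw x p y : Prop := mdist x p + mdist p y = mdist x y.

Lemma btwC x p y : btw x p y -> btw y p x.
Proof.
by rewrite /btw addrC (metric_sym p x) (metric_sym y p) (metric_sym y x).
Qed.

Lemma btwxx x y : btw x x y.
Proof. by rewrite /btw mdistxx add0r. Qed.

Lemma btwyy x y : btw x y y.
Proof. by rewrite /btw mdistxx addr0. Qed.

Lemma btw_id x p : btw x p x -> p = x.
Proof.
rewrite /btw mdistxx metric_sym => h; apply: mdist_positivity.
by have := mdist_ge0 p x; lra.
Qed.

Lemma btw_transl x q p y : btw x p y -> btw x q p -> btw x q y /\ btw q p y.
Proof.
rewrite /btw => h1 h2.
have := metric_triangle q p y; have := metric_triangle x q y.
by split; lra.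
Qed.

Lemma btw_transr x q p y : btw x p y -> btw p q y -> btw x q y /\ btw x p q.
Proof.
move=> /btwC h1 /btwC h2; have [h3 h4] := btw_transl h1 h2.
by split; apply: btwC.
Qed.

Lemma btw_antisym x p q : btw x p q -> btw x q p -> p = q.
Proof.
rewrite /btw (metric_sym q p) => h1 h2; apply: mdist_positivity.
by have := mdist_ge0 p q; lra.
Qed.

Lemma btw_near x y s : mdist x y < mdist x s -> ~ btw x s y.
Proof. by rewrite /btw => h1 h2; have := mdist_ge0 s y; lra. Qed.

Lemma closed_segment x y : closed [set p : T | btw x p y].
Proof.
rewrite -openC openE => p /= nb; apply/nbhs_ballP.
pose e := (mdist x p + mdist p y - mdist x y) / 2.
have e0 : 0 < e.
  rewrite divr_gt0// subr_gt0 lt_neqAle metric_triangle andbT.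
  by apply/eqP => h; apply: nb.
exists e => //= q; rewrite ballEmdist/= => pq b; move: pq.
have := metric_triangle x q p; have := metric_triangle p q y.
by move: b; rewrite /e /btw (metric_sym q p); lra.
Qed.

End betweenness.

Section tree_metric.
Context {R : realType} {T : metricType R} (treeT : @real_tree R T).
Implicit Types (x y z p q : T).

(** No tree axiom is involved: betweenness of [p] leaves no room for a shortcut,
    as the triangle inequalities through [x], [p] and [y] are all equalities. *)
Lemma geodesic_cat x p y f g :
  geodesic x p f -> geodesic p y g -> btw x p y ->
  geodesic x y (fun t => if t <= mdist x p then f t else g (t - mdist x p)).
Proof.
move=> [f0 f1 fi] [g0 g1 gi] b; rewrite /btw in b.
have a0 := mdist_ge0 x p; have c0 := mdist_ge0 p y.
have inA t : 0 <= t -> t <= mdist x p -> t \in `[0, mdist x p].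
  by move=> ? ?; rewrite in_itv/=; apply/andP.
have inB t : mdist x p <= t -> t <= mdist x y -> t - mdist x p \in `[0, mdist p y].
  by move=> ? ?; rewrite in_itv/=; apply/andP; lra.
have cross s t : 0 <= s -> s <= mdist x p -> mdist x p < t -> t <= mdist x y ->
    mdist (f s) (g (t - mdist x p)) = t - s.
  move=> s0 sa ta tD.
  have e1 : mdist x (f s) = s.
    by rewrite -f0 fi ?inA ?lexx// sub0r normrN ger0_norm.
  have e2 : mdist (f s) p = mdist x p - s.
    by rewrite -{1}f1 fi ?inA ?lexx// distrC ger0_norm// subr_ge0.
  have h : 0 <= t - mdist x p by rewrite subr_ge0 ltW.
  have e3 : mdist p (g (t - mdist x p)) = t - mdist x p.
    rewrite -{1}g0 gi ?inB ?(ltW ta)// ?sub0r ?normrN ?ger0_norm//.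
    by rewrite in_itv/= lexx.
  have e4 : mdist (g (t - mdist x p)) y = mdist x y - t.
    rewrite -{1}g1 gi ?inB ?(ltW ta)// ?in_itv/= ?lexx ?c0//.
    by rewrite ler0_norm; lra.
  have t1 := metric_triangle (f s) p (g (t - mdist x p)).
  have t2 := metric_triangle x (f s) y.
  have t3 := metric_triangle (f s) (g (t - mdist x p)) y.
  lra.
split.
- by rewrite a0.
- case: ifPn => [h|_].
    have e : mdist p y = 0 by lra.
    have -> : mdist x y = mdist x p by lra.
    by rewrite f1; apply: mdist_positivity.
  by have -> : mdist x y - mdist x p = mdist p y by lra.
- move=> s t; rewrite !in_itv/= => /andP[s0 sD] /andP[t0 tD].
  case: (leP s (mdist x p)) => sa; case: (leP t (mdist x p)) => ta.
  + by rewrite fi ?inA.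
  + by rewrite cross// ler0_norm; lra.
  + by rewrite metric_sym cross// ger0_norm; lra.
  + by rewrite gi ?inB ?(ltW sa) ?(ltW ta)//; congr (`|_|); lra.
Qed.

Lemma geodesic_btw x y f t : geodesic x y f -> t \in `[0, mdist x y] ->
  btw x (f t) y /\ mdist x (f t) = t.
Proof.
move=> [f0 f1 fi] tD; have D0 := mdist_ge0 x y.
move: (tD); rewrite in_itv/= => /andP[t0 t1].
have e1 : mdist x (f t) = t.
  by rewrite -f0 fi// ?sub0r ?normrN ?ger0_norm// in_itv/= lexx.
split=> //; rewrite /btw e1 -{1}f1 fi// ?in_itv/= ?lexx ?D0//.
by rewrite ler0_norm; lra.
Qed.

Lemma segmentE x y : segment x y = [set p | btw x p y].
Proof.
apply/seteqP; split => [p [f gf [t tD <-]]|p b] /=.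
  by have [] := geodesic_btw gf tD.
have [[f gf] [g gg]] := (treeT.1 x p, treeT.1 p y).
exists (fun t => if t <= mdist x p then f t else g (t - mdist x p)).
  exact: geodesic_cat.
exists (mdist x p); last by rewrite lexx; case: gf.
rewrite /= in_itv/= mdist_ge0 -b lerDl; exact: mdist_ge0.
Qed.

Lemma point_at x y (t : R) : 0 <= t -> t <= mdist x y ->
  exists2 p, btw x p y & mdist x p = t.
Proof.
move=> t0 t1; have [f gf] := treeT.1 x y.
have [|b e] := geodesic_btw gf (t := t); first by rewrite in_itv/= t0.
by exists (f t).
Qed.

Lemma midpoint x y : x <> y -> exists m, [/\ btw x m y, m <> x & m <> y].
Proof.
move=> /eqP; rewrite -mdist_gt0 => d0.
have [||m b e] := @point_at x y (mdist x y / 2); rewrite ?divr_ge0 ?(ltW d0)//.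
  by lra.
exists m; split=> // mx; [move: e|move: e]; rewrite mx ?mdistxx; lra.
Qed.

Lemma lipschitz_continuous (h : R -> T) (K : R) (A : set R) : 0 < K ->
  {in A &, forall s t, mdist (h s) (h t) <= K * `|s - t|} ->
  {within A, continuous h}.
Proof.
move=> K0 hl; apply/subspace_continuousP => s As.
apply/(@metricType_numDomainType.cvgrPdist_lt R T) => e e0; rewrite near_withinE.
have eK : 0 < e / K by rewrite divr_gt0.
near=> t => At; apply: le_lt_trans (hl s t _ _) _; rewrite ?inE//.
by rewrite mulrC -ltr_pdivlMr//; near: t; exact: cvgr_dist_lt.
Unshelve. all: by end_near. Qed.

(** The axiom on injective paths speaks of the parameter interval [0, 1];
    a Lipschitz bound is the only form of continuity that the paths built below
    need, and it survives the gluing of two geodesics. *)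
Lemma arc_btw (h : R -> T) (L : R) : 0 <= L ->
  {in `[0, L] &, forall s t, mdist (h s) (h t) <= `|s - t|} ->
  {in `[0, L] &, injective h} ->
  forall z, btw (h 0) z (h L) <-> exists2 t, t \in `[0, L] & z = h t.
Proof.
move=> L0; rewrite le_eqVlt in L0; case/predU1P: L0 => [<-|L0] hl hi z.
  split=> [/btw_id ->|[t]]; first by exists 0; rewrite // in_itv/= lexx.
  rewrite in_itv/= -eq_le => /eqP <- ->; exact: btwxx.
have inL t : t \in `[0, 1] -> t * L \in `[0, L].
  rewrite !in_itv/= => /andP[t0 t1].
  by rewrite mulr_ge0 ?(ltW L0)//= ler_piMl// ltW.
have := treeT.2 (fun t => h (t * L)).
rewrite mul0r mul1r segmentE.
rewrite -[btw _ z _]/([set p | btw (h 0) p (h L)] z) => <-.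
- split=> [[t t1 <-]|[t tL ->]]; first by exists (t * L) => //; exact: inL.
  exists (t / L); last by rewrite divfK// gt_eqF.
  move: tL; rewrite /= !in_itv/= => /andP[t0 t1].
  by rewrite divr_ge0 ?(ltW L0)//= ler_pdivrMr// mul1r.
- apply: (@lipschitz_continuous _ L) => // s t; rewrite !inE/= => s1 t1.
  rewrite (le_trans (hl _ _ (inL _ _) (inL _ _)))//.
  by rewrite -mulrBl normrM (gtr0_norm L0) mulrC.
- move=> s t; rewrite !inE/= => s1 t1 e.
  have L_neq0 : L != 0 by rewrite gt_eqF.
  exact: (mulIf L_neq0 (hi _ _ (inL _ s1) (inL _ t1) e)).
Qed.

Lemma geodesic_lip x y f : geodesic x y f ->
  {in `[0, mdist x y] &, forall s t, mdist (f s) (f t) <= `|s - t|}.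
Proof. by move=> [_ _ fi] s t s1 t1; rewrite fi. Qed.

Lemma geodesic_inj x y f : geodesic x y f -> {in `[0, mdist x y] &, injective f}.
Proof.
move=> [_ _ fi] s t s1 t1 e; apply/eqP; rewrite -subr_eq0 -normr_eq0.
by rewrite -fi// e mdistxx.
Qed.

Lemma btw_geodesic x y f p : geodesic x y f -> btw x p y -> p = f (mdist x p).
Proof.
move=> gf; have [f0 f1 _] := gf.
have := arc_btw (mdist_ge0 x y) (geodesic_lip gf) (geodesic_inj gf) p.
rewrite f0 f1 => -[+ _] => /[apply] -[t tD e].
by have [_] := geodesic_btw gf tD; rewrite -e => ->.
Qed.

(** Two geodesics with the same endpoints have the same image, hence visit the
    same point at the same time. *)
Lemma btw_uniq x y p q : btw x p y -> btw x q y -> mdist x p = mdist x q -> p = q.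
Proof.
have [f gf] := treeT.1 x y => bp bq e.
by rewrite (btw_geodesic gf bp) e -(btw_geodesic gf bq).
Qed.

Lemma btw_linear x y p q :
  btw x p y -> btw x q y -> mdist x p <= mdist x q -> btw x p q.
Proof.
move=> bp bq le; have [p' bp' e] := point_at (mdist_ge0 x p) le.
suff -> : p = p' by [].
by have [bp'y _] := btw_transl bq bp'; exact: (btw_uniq bp bp'y).
Qed.

(** The median is the first point [p] of a geodesic from [x] to [y] that lies on
    the segment from [y] to [z]. Following the geodesic up to [p] and then the
    segment from [p] to [z] never visits a point twice, by minimality of [p], so
    this path is the segment from [x] to [z] and [p] lies on it. *)
Lemma median x y z : exists m, [/\ btw x m y, btw y m z & btw x m z].
Proof.
have [f gf] := treeT.1 x y; have [f0 f1 fi] := gf.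
pose S := [set t | t \in `[0, mdist x y] /\ btw y (f t) z].
have D0 := mdist_ge0 x y.
have SD : S (mdist x y).
  by split; [rewrite in_itv/= lexx D0|rewrite f1; exact: btwxx].
have lbS : lbound S 0 by move=> t [+ _]; rewrite in_itv/= => /andP[].
have infS : has_inf S by split; [exists (mdist x y)|exists 0].
set t0 := inf S.
have t0_ge0 : 0 <= t0 by apply: lb_le_inf => //; exists (mdist x y).
have t0_leD : t0 <= mdist x y by apply: ge_inf => //; exists 0.
have t0D : t0 \in `[0, mdist x y] by rewrite in_itv/= t0_ge0.
have [bp ep] := geodesic_btw gf t0D.
set p := f t0 in bp ep.
(* The segment from [y] to [z] is closed, so the infimum is attained. *)
have yp : btw y p z.
  apply/eqP; rewrite eq_le; apply/andP; split; last exact: metric_triangle.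
  apply/ler_addgt0Pl => e e0.
  have [|t [tD bt] lt] := @inf_adherent _ S (e / 2) _ infS; first by rewrite divr_gt0.
  have le : t0 <= t by apply: ge_inf => //; exists 0.
  have pt : mdist p (f t) = t - t0 by rewrite fi// ler0_norm; lra.
  have := metric_triangle y (f t) p; have := metric_triangle p (f t) z.
  rewrite /btw in bt; rewrite (metric_sym (f t) p) -/t0 in lt *; lra.
exists p; split=> //.
have [g gg] := treeT.1 p z; have [g0 g1 gi] := gg.
pose h t := if t <= t0 then f t else g (t - t0).
have M0 := mdist_ge0 p z.
have L0 : 0 <= t0 + mdist p z by rewrite addr_ge0.
have inA t : 0 <= t -> t <= t0 -> t \in `[0, mdist x y].
  by move=> ? ?; rewrite in_itv/=; apply/andP; split=> //; lra.
have inB t : t0 < t -> t <= t0 + mdist p z -> t - t0 \in `[0, mdist p z].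
  by move=> ? ?; rewrite in_itv/=; apply/andP; lra.
have fp t : 0 <= t -> t <= t0 -> mdist (f t) p = t0 - t.
  by move=> t1 t2; rewrite fi ?inA// ler0_norm; lra.
have gp t : t0 < t -> t <= t0 + mdist p z -> mdist p (g (t - t0)) = t - t0.
  by move=> t1 t2; have [] := geodesic_btw gg (inB _ t1 t2).
have hl : {in `[0, t0 + mdist p z] &, forall s t, mdist (h s) (h t) <= `|s - t|}.
  move=> s t; rewrite !in_itv/= /h => /andP[s0 sD] /andP[u0 tD].
  case: (leP s t0) => sa; case: (leP t t0) => ta.
  - by rewrite fi ?inA.
  - have := metric_triangle (f s) p (g (t - t0)).
    by rewrite fp// gp// ler0_norm; lra.
  - have := metric_triangle (f t) p (g (s - t0)).
    by rewrite fp// gp// (metric_sym (g _)) ger0_norm; lra.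
  - rewrite gi ?inB// le_eqVlt; apply/orP; left; apply/eqP; congr (`|_|); lra.
have cross s t : 0 <= s -> s <= t0 -> t0 < t -> t <= t0 + mdist p z ->
    f s <> g (t - t0).
  move=> s0 sa ta tD e.
  have bg : btw y (g (t - t0)) z.
    have [b _] := geodesic_btw gg (inB _ ta tD).
    by have [] := btw_transr yp b.
  have : t0 <= s.
    by apply: ge_inf; [exists 0|split; [exact: inA|rewrite e]].
  by have := fp s s0 sa; rewrite e metric_sym gp//; lra.
have hi : {in `[0, t0 + mdist p z] &, injective h}.
  move=> s t; rewrite !in_itv/= /h => /andP[s0 sD] /andP[u0 tD].
  case: (leP s t0) => sa; case: (leP t t0) => ta.
  - by apply: (geodesic_inj gf); exact: inA.
  - by move/cross => /(_ s0 sa ta tD).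
  - by move/esym/cross => /(_ u0 ta sa sD).
  - move/(geodesic_inj gg) => /(_ (inB _ sa sD) (inB _ ta tD)); lra.
have := arc_btw L0 hl hi p.
have -> : h 0 = x by rewrite /h t0_ge0.
have -> : h (t0 + mdist p z) = z.
  rewrite /h; case: ifPn => [le|_].
    have e : mdist p z = 0 by lra.
    by rewrite e addr0; apply: mdist_positivity.
  by rewrite addrC addKr.
move=> [_]; apply; exists t0; last by rewrite /h lexx.
by rewrite in_itv/= t0_ge0 lerDl.
Qed.

(** Contrapositive of the transitivity of the relation [~ btw x s y]; the point
    [s] falls on one of the two sides of the median of [x], [y], [z]. *)
Lemma btw_split x s y z : btw x s z -> btw x s y \/ btw y s z.
Proof.
move=> b; have [m [bxy byz bxz]] := median x y z.
have [le|/ltW le] := leP (mdist x s) (mdist x m).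
  by left; have [] := btw_transl bxy (btw_linear b bxz le).
right; have [|+ _] := @btw_transr _ _ y s m z byz; last by [].
by have [_] := btw_transl b (btw_linear bxz b le).
Qed.

Lemma segment_connected x y : connected [set p | btw x p y].
Proof.
have [f gf] := treeT.1 x y.
have -> : [set p | btw x p y] = f @` `[0, mdist x y].
  apply/seteqP; split=> [p /= b|_ [t tD <-]].
    exists (mdist x p); last by rewrite -(btw_geodesic gf b).
    by rewrite /= in_itv/= mdist_ge0 -b lerDl mdist_ge0.
  by have [] := geodesic_btw gf tD.
apply: connected_continuous_connected; first exact: normed_module.segment_connected.
apply: (@lipschitz_continuous _ 1) => // s t; rewrite !inE mul1r.
exact: (geodesic_lip gf).
Qed.

Lemma open_side x s : open [set y | ~ btw x s y].
Proof.
rewrite openE => y /= nb; apply/nbhs_ballP.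
have ys : s <> y by move=> e; apply: nb; rewrite e; exact: btwyy.
exists (mdist y s); first by rewrite /= mdist_gt0; apply/eqP => /esym.
move=> y'; rewrite ballEmdist/= => /btw_near nb' b; apply: nb'.
by have [] := btw_split y b.
Qed.

(** The class of [x] is open and so is the union of the other classes, hence a
    connected set avoiding [s] meets only one class; conversely the segment from
    [x] to a point of its class is connected and avoids [s]. *)
Lemma connected_component_side s x : x <> s ->
  connected_component (~` [set s]) x = [set y | ~ btw x s y].
Proof.
move=> xs; apply/seteqP; split=> y.
  move=> [B [Bx Bs cB] By] /= bxy.
  pose A := B `&` [set y | ~ btw x s y].
  suff AB : A = B by have := By; rewrite -AB => -[].
  apply: cB.
  - by exists x; split=> // /btw_id/esym.
  - by exists [set y | ~ btw x s y] => //; exact: open_side.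
  - exists [set y | y = s \/ ~ btw x s y].
      rewrite -openC openE => z /= /not_orP[zs /contrapT b].
      apply/nbhs_ballP; exists (mdist z s); first by rewrite /= mdist_gt0; apply/eqP.
      move=> z'; rewrite ballEmdist/= => d.
      have nb := btw_near d => -[z's|]; first by rewrite z's ltxx in d.
      by apply; have [//|/btwC/nb] := btw_split z' b.
    apply/seteqP; split=> z [Bz Az]; first exact: (conj Bz (or_intror Az)).
    by case: Az => [/(Bs z Bz)//|nb]; exact: (conj Bz nb).
move=> nb; apply: (@connected_component_max _ _ [set p | btw x p y] x).
- exact: btwxx.
- by move=> p b /= ps; apply: nb; rewrite -ps.
- exact: segment_connected.
- exact: btwyy.
Qed.

End tree_metric.

(** * Components, meets and branch points *)

Section branching.
Context {R : realType} {T : metricType R} (treeT : @real_tree R T).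
Variable rho : T.
Implicit Types (x y z p q u v : T).

(** Sides of [z] are the classes of an equivalence relation. *)
Lemma side_eq u v z : ~ btw u z v ->
  [set y | ~ btw u z y] = [set y | ~ btw v z y].
Proof.
move=> uv; apply/seteqP; split=> y /= nb b; apply: nb.
  by have [/btwC|] := btw_split treeT u b.
by have [|] := btw_split treeT v b.
Qed.

(** This is why [branch_meet] is the median of [rho], [x] and [y]. *)
Lemma meet_segment x y m : btw rho m x -> btw rho m y -> btw x m y ->
  segment rho m = segment rho x `&` segment rho y.
Proof.
move=> bx b_y bxy; rewrite !(segmentE treeT); apply/seteqP; split=> p /=.
  by move=> pm; split; [have [] := btw_transl bx pm|have [] := btw_transl b_y pm].
move=> [px py]; have [le|/ltW le] := leP (mdist rho p) (mdist rho m).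
  exact: (btw_linear treeT px bx).
have [_ mpx] := btw_transl px (btw_linear treeT bx px le).
have [_ mpy] := btw_transl py (btw_linear treeT b_y py le).
have -> : p = m.
  apply: mdist_positivity; have := metric_triangle x p y; have := mdist_ge0 p m.
  move: bxy mpx mpy; rewrite /btw (metric_sym x m) (metric_sym x p) (metric_sym m p).
  by lra.
exact: btwyy.
Qed.

Lemma branch_meetE x y m : btw rho m x -> btw rho m y -> btw x m y ->
  branch_meet rho x y = m.
Proof.
move=> bx b_y bxy; have e := meet_segment bx b_y bxy.
apply: xget_unique => [//|z /= ez].
move: (ez); rewrite -e !(segmentE treeT) => E.
apply: (@btw_antisym _ _ rho).
  suff : [set p | btw rho p m] z by [].
  by rewrite -E; exact: btwyy.
suff : [set p | btw rho p z] m by [].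
by rewrite E; exact: btwyy.
Qed.

Lemma componentsP z A :
  components (~` [set z]) A <-> exists2 u, u <> z & A = [set y | ~ btw u z y].
Proof.
split=> [[u uz <-]|[u uz ->]]; exists u => //.
- exact: connected_component_side.
- exact: connected_component_side.
Qed.

Lemma upper_componentsP z A : upper_components rho z A <->
  exists u, [/\ btw rho z u, u <> z & A = [set y | ~ btw u z y]].
Proof.
split=> [[/componentsP[u uz ->] /contrapT /btwC b]|[u [b uz ->]]].
  by exists u.
by split; [apply/componentsP; exists u|move/(_ (btwC b))].
Qed.

(** A branch point is characterised by two descendants that it separates: the
    third component is the one of [rho]. From three components, two do not
    contain [rho]; which two is decided by [btw_split]. *)
Lemma BrP p : Br rho p <->
  p <> rho /\ exists u v,
    [/\ btw rho p u, u <> p, btw rho p v, v <> p & btw u p v].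
Proof.
split=> [[prho /pcard_leP[f]]|[prho [u [v [bu up bv vp uv]]]]]; split=> //.
  have side n : (n < 3)%N ->
      exists2 u, u <> p & f n = [set y | ~ btw u p y].
    by move=> n3; apply/componentsP; exact: (@funS _ _ _ _ f).
  have [u0 u0p e0] := side 0%N isT.
  have [u1 u1p e1] := side 1%N isT.
  have [u2 u2p e2] := side 2%N isT.
  have sep m n u v : m <> n -> (m < 3)%N -> (n < 3)%N ->
      f m = [set y | ~ btw u p y] -> f n = [set y | ~ btw v p y] -> btw u p v.
    move=> mn m3 n3 em en; apply: contrapT => /side_eq.
    by rewrite -em -en => /(@inj _ _ _ f); rewrite !inE => /(_ m3 n3)/mn.
  have b01 : btw u0 p u1 by exact: (sep 0 1)%N.
  have b02 : btw u0 p u2 by exact: (sep 0 2)%N.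
  have b12 : btw u1 p u2 by exact: (sep 1 2)%N.
  have [r0|n0] := pselect (btw rho p u0); last first.
    exists u1, u2; split=> //.
    - by have [/btwC|] := btw_split treeT rho b01.
    - by have [/btwC|] := btw_split treeT rho b02.
  have [r1|n1] := pselect (btw rho p u1); first by exists u0, u1.
  exists u0, u2; split=> //.
  by have [/btwC|] := btw_split treeT rho b12.
pose w n := nth rho [:: rho; u; v] n.
pose f n := [set y | ~ btw (w n) p y].
have wp n : w n <> p.
  case: n => [|[|[|n]]]; rewrite /w/= ?nth_nil => //; exact: nesym.
have wb m n : (m < n)%N -> (n < 3)%N -> btw (w m) p (w n).
  by case: m => [|[|[|m]]]; case: n => [|[|[|n]]].
have finj : set_inj `I_3 f.
  have lt m n : (m < n)%N -> (n < 3)%N -> f m <> f n.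
    move=> mn n3 e; have : f n (w n) by move=> /btw_id/esym/wp.
    by rewrite -e; apply; exact: wb.
  move=> m n; rewrite !inE => m3 n3 e; case: (ltngtP m n) => // mn.
    by have := lt _ _ mn n3.
  by have := lt _ _ mn m3 (esym e).
rewrite -(card_le_eql (inj_card_eq finj)); apply: subset_card_le.
by move=> _ [n n3 <-]; apply/componentsP; exists (w n).
Qed.

Lemma Br_other p u : Br rho p -> btw rho p u -> u <> p ->
  exists v, [/\ btw rho p v, v <> p & btw u p v].
Proof.
move=> /BrP[_ [v [v' [bv vp bv' vp' vv']]]] bu up.
have [/btwC b|b] := btw_split treeT u vv'; [by exists v|by exists v'].
Qed.

(** A branch point is the meet of any two points chosen in two components above
    it. These components are open, so each of them contains a set of a countable
    basis, and choosing one point in every set of the basis produces all branch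
    points as meets. *)
Lemma countable_Br : compact [set: T] -> countable (Br rho).
Proof.
move=> cT; have [B cB [_ basisB]] :=
  @compact_second_countable R (rooted rho) cT.
pose g (V : set T * set T) := branch_meet rho (xget rho V.1) (xget rho V.2).
apply: (@sub_countable _ _ _ (g @` (B `*` B))); last first.
  exact: (sub_countable (card_image_le _ _) (countableX cB cB)).
apply: subset_card_le => p /BrP[_ [u [v [bu up bv vp uv]]]].
have pick x : x <> p ->
    exists2 V, B V & ~ btw x p (xget rho V).
  move=> xp; have := basisB x [set y | ~ btw x p y].
  case=> [|V [BV Vx] VS].
    by apply: open_nbhs_nbhs; split; [exact: open_side|move/btw_id/esym].
  by exists V => //; apply: VS; exact: (xgetPex rho (ex_intro _ x Vx)).
have [[V BV Vu] [W BW Wv]] := (pick u up, pick v vp).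
exists (V, W) => //=; rewrite /g/=; apply: branch_meetE.
- by have [/Vu|/btwC] := btw_split treeT (xget rho V) (btwC bu).
- by have [/Wv|/btwC] := btw_split treeT (xget rho W) (btwC bv).
- have [/Vu//|b] := btw_split treeT (xget rho V) uv.
  by have [|/btwC/Wv] := btw_split treeT (xget rho W) b.
Qed.

Section enumeration.
Context {I : T -> set nat} {C : T -> nat -> set T}.
Hypothesis enumC : component_enumeration rho I C.

Lemma enum_upper z k : I z k ->
  exists u, [/\ btw rho z u, u <> z & C z k = [set y | ~ btw u z y]].
Proof. by have [_ [f _ _]] := enumC z => Ik; apply/upper_componentsP; exact: f. Qed.

Lemma enum_sideE z k y : I z k -> C z k y ->
  C z k = [set y' | ~ btw y z y'].
Proof. by move=> /enum_upper[u [_ _ ->]] /side_eq. Qed.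

Lemma enum_anc z k y : I z k -> C z k y -> btw rho z y /\ y <> z.
Proof.
move=> /enum_upper[u [b uz ->]] /= nb; split.
  by have [/nb|/btwC] := btw_split treeT y (btwC b).
by move=> yz; apply: nb; rewrite yz; exact: btwyy.
Qed.

Lemma enum_ex z y : btw rho z y -> y <> z -> exists2 k, I z k & C z k y.
Proof.
move=> b yz; have [_ [_ _ /(_ [set y' | ~ btw y z y'])]] := enumC z.
case=> [|k Ik e]; first by apply/upper_componentsP; exists y.
by exists k => //; rewrite e => /btw_id/esym.
Qed.

Lemma enum_inj z k l y : I z k -> I z l -> C z k y -> C z l y -> k = l.
Proof.
move=> Ik Il Ck Cl; have [_ [_ f _]] := enumC z.
by apply: f; rewrite ?inE// (enum_sideE Ik Ck) (enum_sideE Il Cl).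
Qed.

End enumeration.
End branching.

(** * Competing pairs of independent uniform variables *)

Lemma uniform_prob_lt_half (R : realType) :
  uniform_prob (@ltr01 R) `]-oo, 2^-1[ = (2^-1)%:E.
Proof.
rewrite /uniform_prob integral_uniform_pdf.
have -> : `]-oo, (2^-1 : R)[ `&` `[0, 1] = [set` `[0, 2^-1[].
  apply/seteqP; split=> x /=; rewrite !in_itv/=.
    by move=> [-> /andP[-> _]].
  by move=> /andP[x0 x1]; rewrite x0 x1; split=> //=; lra.
rewrite (eq_integral (cst (1 : R)%:E)); last first.
  move=> x; rewrite inE/= in_itv/= => /andP[x0 x1].
  by rewrite /uniform_pdf x0 subr0 invr1 ifT//=; lra.
rewrite integral_cst//= mul1e lebesgue_measure_itv/= lte_fin invr_gt0 ltr0n.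
by rewrite oppr0 adde0.
Qed.

Section iid_pairs.
Context {d : measure_display} {Omega : measurableType d} {R : realType}.
Context {P : probability Omega R} {J : choiceType} {D : set J}.
Context {X : J -> {RV P >-> R}} (iidX : iid_uniform01 D X).

Definition cylinder (F : {fset J}) (A : J -> set R) : set Omega :=
  \bigcap_(j in [set` F]) (X j @^-1` A j).

Definition cylinder_over (F : {fset J}) (A : J -> set R) : Prop :=
  forall j, j \in F -> D j /\ measurable (A j).

Lemma measurable_preRV j (B : set R) : measurable B -> measurable (X j @^-1` B).
Proof. exact: (measurable_funPTI (X j)). Qed.

Lemma measurable_cylinder F A : cylinder_over F A -> measurable (cylinder F A).
Proof.
move=> FA; apply: fin_bigcap_measurable => // j /FA[_].
exact: measurable_preRV.
Qed.

Lemma cylinderU1 F A i B : i \notin F ->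
  X i @^-1` B `&` cylinder F A =
  cylinder (i |` F)%fset (fun j => if j == i then B else A j).
Proof.
move=> iF; rewrite /cylinder bigcap_fsetU1 eqxx; congr (_ `&` _).
by apply: eq_bigcapr => j /= jF; case: eqP => // ji; rewrite -ji jF in iF.
Qed.

Lemma cylinder_overU1 F A i B : cylinder_over F A -> D i -> measurable B ->
  cylinder_over (i |` F)%fset (fun j => if j == i then B else A j).
Proof.
move=> FA Di mB j; rewrite !inE => /orP[/eqP ->|/FA[Dj mA]].
  by rewrite eqxx.
by split=> //; case: ifP.
Qed.

Lemma prob_cylinderU1 F A i B : cylinder_over F A -> D i -> measurable B ->
  i \notin F ->
  P (X i @^-1` B `&` cylinder F A) = (P (X i @^-1` B) * P (cylinder F A))%E.
Proof.
move=> FA Di mB iF; rewrite cylinderU1//.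
rewrite iidX.1; last exact: cylinder_overU1.
rewrite iidX.1// big_fsetU1//= eqxx; congr (_ * _)%E.
rewrite big_seq [RHS]big_seq; apply: eq_bigr => j jF.
by case: eqP => // ji; rewrite -ji jF in iF.
Qed.

Lemma prob_lt_half i : D i -> P (X i @^-1` `]-oo, 2^-1[) = (2^-1)%:E.
Proof.
move=> Di; rewrite -uniform_prob_lt_half.
by rewrite -(iidX.2 _ Di)//; exact: measurable_itv.
Qed.

Lemma prob_ge_half i : D i -> P (X i @^-1` `[2^-1, +oo[) = (2^-1)%:E.
Proof.
move=> Di; rewrite -setCitvl preimage_setC probability_setC.
  by rewrite prob_lt_half// -EFinB; congr (_%:E); lra.
exact: (measurable_preRV i (measurable_itv _)).
Qed.

Variables (a b : nat -> J).
Hypotheses (Da : forall n, D (a n)) (Db : forall n, D (b n)).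
Hypotheses (a_inj : injective a) (b_inj : injective b).
Hypothesis (ab : forall m n, a m <> b n).

(** Comparing both variables with 1/2, instead of with each other, makes this a
    product event, whose probability 1/4 follows from independence alone. *)
Definition separated_by_half n : set Omega :=
  X (a n) @^-1` `]-oo, 2^-1[ `&` X (b n) @^-1` `[2^-1, +oo[.

Lemma measurable_separated n : measurable (separated_by_half n).
Proof.
exact: measurableI (measurable_preRV _ (measurable_itv _))
  (measurable_preRV _ (measurable_itv _)).
Qed.

Definition never_separated N : set Omega :=
  \bigcap_(n in `I_N) ~` separated_by_half n.

Lemma never_separatedS N :
  never_separated N.+1 = never_separated N `\` separated_by_half N.
Proof.
apply/seteqP; split=> [w h|w [h hN] n /=].
  by split=> [n /= nN|]; apply: h; rewrite /= ltnS// ltnW.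
by rewrite ltnS leq_eqVlt => /predU1P[-> //|]; exact: h.
Qed.

Lemma measurable_never_separated N : measurable (never_separated N).
Proof.
apply: fin_bigcap_measurable => [|n _]; first exact: finite_II.
apply: measurableC; exact: measurable_separated.
Qed.

(** Carrying an arbitrary cylinder along closes the induction: subtracting the
    event that the last pair is separated only adds two coordinates to the
    cylinder, whence a factor [1 - 1/4]. *)
Lemma prob_never_separated N F A : cylinder_over F A ->
  (forall n, (n < N)%N -> a n \notin F /\ b n \notin F) ->
  P (cylinder F A `&` never_separated N) =
    (((3 / 4) ^+ N)%:E * P (cylinder F A))%E.
Proof.
elim: N F A => [|N IH] F A FA abF.
  by rewrite /never_separated II0 bigcap_set0 setIT expr0 mul1e.
have [aF bF] := abF N (ltnSn N).
have mE : measurable (cylinder F A `&` never_separated N).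
  exact: measurableI (measurable_cylinder FA) (measurable_never_separated N).
have -> : P (cylinder F A `&` never_separated N.+1) =
    (P (cylinder F A `&` never_separated N) -
     P (cylinder F A `&` never_separated N `&` separated_by_half N))%E.
  rewrite never_separatedS setIDA; apply: measureD => //.
    exact: measurable_separated.
  by rewrite (le_lt_trans (probability_le1 _ mE))// ltry.
rewrite IH//; last by move=> n nN; apply: abF; rewrite ltnS ltnW.
pose F1 := (b N |` F)%fset.
pose A1 j := if j == b N then `[2^-1, +oo[%classic else A j.
have FA1 : cylinder_over F1 A1 by apply: cylinder_overU1 => //; exact: measurable_itv.
have aF1 : a N \notin F1 by rewrite !inE negb_or aF andbT; apply/eqP.
pose F2 := (a N |` F1)%fset.
pose A2 j := if j == a N then `]-oo, 2^-1[%classic else A1 j.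
have FA2 : cylinder_over F2 A2 by apply: cylinder_overU1 => //; exact: measurable_itv.
have E1 : cylinder F1 A1 = X (b N) @^-1` `[2^-1, +oo[ `&` cylinder F A.
  by rewrite cylinderU1.
have E2 : cylinder F2 A2 = X (a N) @^-1` `]-oo, 2^-1[ `&` cylinder F1 A1.
  by rewrite cylinderU1.
have -> : cylinder F A `&` never_separated N `&` separated_by_half N =
    cylinder F2 A2 `&` never_separated N.
  rewrite E2 E1; apply/seteqP.
  by split=> w; [case=> -[? ?] []|case=> -[? [? ?]] ?].
rewrite IH//; last first.
  move=> n nN; have [anF bnF] := abF n (leqW nN).
  have nn : n <> N by move=> e; rewrite e ltnn in nN.
  rewrite !inE !negb_or anF bnF !andbT; split; apply/andP; split; apply/eqP => //.
  - by move/a_inj.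
  - by move/esym; exact: ab.
  - by move/b_inj.
rewrite E2 (prob_cylinderU1 FA1 (Da N) (measurable_itv _) aF1).
rewrite E1 (prob_cylinderU1 FA (Db N) (measurable_itv _) bF).
rewrite prob_lt_half// prob_ge_half//.
have : P (cylinder F A) \is a fin_num.
  by apply: fin_num_measure; exact: measurable_cylinder.
move=> /fineK <-; rewrite -!EFinM -EFinB; congr (_%:E).
by rewrite exprS; lra.
Qed.

Lemma negligible_never_le :
  P.-negligible [set w | forall n, ~ X (a n) w <= X (b n) w].
Proof.
exists (\bigcap_n ~` separated_by_half n); split.
- apply: bigcapT_measurable => n; apply: measurableC.
  exact: measurable_separated.
- apply/eqP; rewrite eq_le measure_ge0 andbT.
  have mcap : measurable (\bigcap_n ~` separated_by_half n).
    apply: bigcapT_measurable => n; apply: measurableC.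
    exact: measurable_separated.
  have le N : (P (\bigcap_n ~` separated_by_half n) <= ((3 / 4 : R) ^+ N)%:E)%E.
    have h : cylinder_over fset0 (fun=> setT) by [].
    have := prob_never_separated h (N := N).
    rewrite /cylinder set_fset0 bigcap_set0 setTI probability_setT mule1 => <- //.
    apply: le_measure; rewrite ?inE//; first exact: measurable_never_separated.
    by move=> w h' n _; exact: h'.
  have : P (\bigcap_n ~` separated_by_half n) \is a fin_num.
    exact: fin_num_measure.
  move=> finP; rewrite -(fineK finP) lee_fin.
  have cvg0 : (fun N => (3 / 4 : R) ^+ N) @ \oo --> (0 : R).
    by apply: cvg_expr; rewrite ger0_norm; lra.
  rewrite -(cvg_lim _ cvg0)//; apply: limr_ge; first by apply/cvg_ex; exists 0.
  by apply: nearW => N; rewrite -lee_fin fineK.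
- move=> w /= h n _ [/=]; rewrite !in_itv/= andbT => lt ge.
  by apply: (h n); rewrite (le_trans (ltW lt)).
Qed.

End iid_pairs.

Lemma negligible_countable_bigcup d (Omega : measurableType d) (R : realType)
    (mu : {measure set Omega -> \bar R}) (J : Type) (D : set J)
    (F : J -> set Omega) : countable D ->
  (forall j, D j -> mu.-negligible (F j)) ->
  mu.-negligible (\bigcup_(j in D) F j).
Proof.
move=> /pcard_leP[f] negF.
pose G n := \bigcup_(j in D `&` [set j | f j = n]) F j.
apply: (negligibleS (A := \bigcup_n G n)).
  by move=> w [j Dj Fw]; exists (f j) => //; exists j.
apply: negligible_bigcup => n.
have [[j [Dj fj]]|h] := pselect (exists j, D j /\ f j = n).
  apply: negligibleS (negF j Dj) => w [j' [Dj' /= fj'] Fw].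
  suff -> : j = j' by [].
  by apply: (@inj _ _ _ f); rewrite ?inE// [RHS]fj'.
apply: negligibleS (negligible_set0 mu) => w [j [Dj fj] _].
by apply: h; exists j.
Qed.

(** * Intervals of a shuffled order *)

Section shuffled_order.
Context {R : realType} {T : metricType R} (treeT : @real_tree R T).
Variables (rho : T) (I : T -> set nat) (C : T -> nat -> set T).
Hypothesis enumC : component_enumeration rho I C.
Implicit Types (x y z p q u v : T).

Lemma anc_trans x y z : btw rho x y -> btw rho y z -> btw rho x z /\ btw x y z.
Proof. by move=> xy yz; exact: btw_transl yz xy. Qed.

Definition strictly_between x q y :=
  [/\ btw rho x q, btw rho q y, q <> x & q <> y].

(** Density of the branch points in the segment from [x] to [y], stated so that
    it passes at once to subsegments. *)
Definition branching_dense x y := forall x' y',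
  btw rho x x' -> btw rho x' y' -> btw rho y' y -> x' <> y' ->
  exists2 q, strictly_between x' q y' & Br rho q.

Lemma open_descendants x : open [set y | btw rho x y /\ x <> y].
Proof.
apply: open_of_open_subsets => y [b xy]; exists [set y' | ~ btw y x y']; split.
- exact: open_side.
- by move=> /btw_id.
- move=> y' nb; split.
    by have [|/btwC/nb] := btw_split treeT y' b.
  by move=> e; apply: nb; rewrite -e; exact: btwyy.
Qed.

Lemma open_component z k : I z k -> open (C z k).
Proof. by move=> /(enum_upper treeT enumC)[u [_ _ ->]]; exact: open_side. Qed.

Section given_orders.
Variable O : T -> nat -> nat -> Prop.
Let lt := lt_of (tree_order rho I C O).

Definition branches_before x y := exists z k l,
  [/\ I z k /\ I z l, k <> l, C z k x, C z l y & O z k l].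

(** The meet disappears from the description of the order: the two distinct
    components force [z] to be the meet of [x] and [y]. *)
Lemma tree_ltP x y : lt x y <-> (btw rho x y /\ x <> y) \/ branches_before x y.
Proof.
split=> [[+ xy]|[[b xy]|[z [k [l [[Ik Il] kl Ck Cl Okl]]]]]].
- case=> [//|[_]|[_ _ [k [l h]]]]; last by right; exists (branch_meet rho x y), k, l.
  by rewrite (segmentE treeT); left.
- split=> //; apply: Or32; split; last by rewrite (segmentE treeT).
  by left; apply: branch_meetE => //; [exact: btwyy|exact: btwxx].
have [bx xz] := enum_anc treeT enumC Ik Ck.
have [b_y yz] := enum_anc treeT enumC Il Cl.
have bxy : btw x z y.
  apply: contrapT => nb; apply: kl.
  by apply: (enum_inj treeT enumC Ik Il _ Cl); rewrite (enum_sideE treeT enumC Ik Ck).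
split; last first.
  by move=> xy; apply: kl; apply: (enum_inj treeT enumC Ik Il Ck); rewrite xy.
apply: Or33; rewrite (branch_meetE treeT bx b_y bxy).
by split; [exact: nesym|exact: nesym|exists k, l].
Qed.

Lemma anc_lt x y : btw rho x y -> x <> y -> lt x y.
Proof. by move=> b xy; apply/tree_ltP; left. Qed.

Lemma open_gt x : open [set y | lt x y].
Proof.
have -> : [set y | lt x y] =
    [set y | btw rho x y /\ x <> y] `|` [set y | branches_before x y].
  by apply/seteqP; split=> y /tree_ltP.
apply: openU; first exact: open_descendants.
apply: open_of_open_subsets => y [z [k [l [[Ik Il] kl Ck Cl Okl]]]].
exists (C z l); split=> //; first exact: open_component.
by move=> y' Cl'; exists z, k, l.
Qed.

Lemma open_branches_before y : open [set x | branches_before x y].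
Proof.
apply: open_of_open_subsets => x [z [k [l [[Ik Il] kl Ck Cl Okl]]]].
exists (C z k); split=> //; first exact: open_component.
by move=> x' Ck'; exists z, k, l.
Qed.

Lemma measurable_open (A : set (borel rho)) : open (A : set T) -> measurable A.
Proof. by move=> oA; apply: sub_sigma_algebra. Qed.

Lemma measurable_closed (A : set (borel rho)) :
  closed (A : set T) -> measurable A.
Proof.
move=> cA; rewrite -[A]setCK; apply: measurableC; apply: measurable_open.
exact: closed_openC.
Qed.

(** The value of a measure on a set that is not measurable carries no
    information, so positivity has to be shown for a Borel set. *)
Lemma measurable_interval x y :
  measurable ([set p | lt x p /\ lt p y] : set (borel rho)).
Proof.
(* The singleton of [y] is written as the segment from [y] to [y], closed as
   every segment is. *)
have lt_y : [set p | lt p y] =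
    ([set p | btw rho p y] `\` [set p | btw y p y]) `|`
    [set p | branches_before p y].
  apply/seteqP; split=> p /= => [/tree_ltP[[b py]|]|].
  - by left; split=> // /btw_id.
  - by right.
  - case=> [[b nb]|]; last by move=> ?; apply/tree_ltP; right.
    by apply: anc_lt => // py; apply: nb; rewrite py; exact: btwyy.
rewrite (_ : [set p | lt x p /\ lt p y] =
  [set p | lt x p] `&` [set p | lt p y])//.
rewrite lt_y; apply: measurableI.
  by apply: measurable_open; exact: open_gt.
apply: measurableU; last first.
  by apply: measurable_open; exact: open_branches_before.
by apply: measurableD; apply: measurable_closed; exact: closed_segment.
Qed.

Definition branch_before_between x y := exists p k l,
  [/\ strictly_between x p y, I p k /\ I p l, k <> l, C p k y & O p l k].

(** What the random shuffling has to provide. It is asked for branch points [x]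
    and [y] only, to leave countably many conditions. *)
Hypothesis dense_before : forall x y, Br rho x -> Br rho y ->
  btw rho x y -> x <> y -> branching_dense x y -> branch_before_between x y.

(** Density yields branch points [p] and [q] with [x < p < q < y], between which
    branch points are dense again. The component given by [dense_before] for
    [p] and [q] precedes [y] too, since [y] and [q] lie in the same component
    above each point strictly below [q]. *)
Lemma dense_interval x y : btw rho x y -> x <> y -> branching_dense x y ->
  exists V, [/\ open V, V !=set0 &
    V `<=` [set v | [/\ btw rho x v, x <> v & lt v y]]].
Proof.
move=> xy x_y dxy.
have [p [xp py px p_y] Brp] := dxy x y (btwyy _ _) xy (btwyy _ _) x_y.
have [q [pq qy qp q_y] Brq] := dxy p y xp py (btwyy _ _) p_y.
have dpq : branching_dense p q.
  move=> x' y' px' x'y' y'q; apply: dxy => //.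
    by have [] := anc_trans xp px'.
  by have [] := anc_trans y'q qy.
have [b [k [l [[pb bq bp b_q] [Ik Il] kl Ck Ol]]]] :=
  dense_before Brp Brq pq (nesym qp) dpq.
exists (C b l); split.
- exact: open_component.
- have [u [_ ub ->]] := enum_upper treeT enumC Il.
  by exists u => /btw_id/esym.
move=> v Cl; have [bv vb] := enum_anc treeT enumC Il Cl.
have [xb _] := anc_trans xp pb; have [xv _] := anc_trans xb bv.
split=> //.
  by move=> e; rewrite -e in bv vb; exact: (vb (btw_antisym xb bv)).
apply/tree_ltP; right; exists b, l, k; split=> //; first exact: nesym.
rewrite (enum_sideE treeT enumC Ik Ck) /= => /btwC yb.
have [_ /btwC] := anc_trans bq qy.
by move=> /(btw_antisym yb).
Qed.

(** The open set consists of the points that [x] does not separate from [y] and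
    [y] does not separate from [rho]. Such a point [v] branches off from the
    segment strictly between [x] and [y], and it would do so at a branch point
    unless it lies on the segment. *)
Lemma branch_free_interval x y : btw rho x y -> x <> y ->
  (forall q, strictly_between x q y -> ~ Br rho q) ->
  exists V, [/\ open V, V !=set0 & V `<=` [set v | strictly_between x v y]].
Proof.
move=> xy x_y noBr.
exists ([set v | ~ btw y x v] `&` [set v | ~ btw rho y v]); split.
- by apply: openI; exact: open_side.
- have [m [bm mx my]] := midpoint treeT x_y; exists m; split=> /= b.
    by apply: mx; exact: btw_antisym (btwC bm) b.
  have [rm _] := btw_transr xy bm.
  by apply: my; exact: btw_antisym rm b.
move=> v [/= nx ny].
have xv : btw rho x v by have [|/btwC/nx] := btw_split treeT v xy.
have [m [/btwC mv rm my]] := median treeT v rho y.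
have vx : v <> x by move=> e; apply: nx; rewrite e; exact: btwyy.
have vy : v <> y by move=> e; apply: ny; rewrite e; exact: btwyy.
have mx : m <> x by move=> e; apply: nx; apply: btwC; rewrite -e.
have m_y : m <> y by move=> e; apply: ny; rewrite -e.
have xm : btw rho x m.
  have [le|/ltW le] := leP (mdist rho x) (mdist rho m).
    exact: (btw_linear treeT xy rm le).
  have mx' := btw_linear treeT rm xy le; exfalso; apply: mx.
  have [[_ mxv] [_ mxy]] := (anc_trans mx' xv, anc_trans mx' xy).
  have [b|/btwC b] := btw_split treeT x my.
    exact: btw_antisym b (btwC mxv).
  exact: btw_antisym b (btwC mxy).
have [<-|mv'] := pselect (m = v); first by split.
exfalso; apply: (noBr m); first by split.
apply/(BrP treeT); split.
  move=> e; rewrite e in xm mx.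
  by apply: mx; have := btw_id xm.
by exists v, y; split=> //; exact: nesym.
Qed.

Lemma interval_above_ancestor x y : btw rho x y -> x <> y ->
  exists V, [/\ open V, V !=set0 &
    V `<=` [set v | [/\ btw rho x v, x <> v & lt v y]]].
Proof.
move=> xy x_y; have [|ndense] := pselect (branching_dense x y).
  exact: dense_interval.
have [x' [y' [xx' x'y' y'y xy' noBr]]] : exists x' y',
    [/\ btw rho x x', btw rho x' y', btw rho y' y, x' <> y' &
      forall q, strictly_between x' q y' -> ~ Br rho q].
  apply: contrapT => h; apply: ndense => x' y' ? ? ? ?; apply: contrapT => h'.
  by apply: h; exists x', y'; split=> // q sq Bq; apply: h'; exists q.
have [V [oV V0 VS]] := branch_free_interval x'y' xy' noBr.
exists V; split=> // v /VS[x'v vy' vx' v_y'].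
have [xv _] := anc_trans xx' x'v; have [vy _] := anc_trans vy' y'y.
split=> //.
  by move=> e; rewrite e in xx'; exact: (vx' (btw_antisym xx' x'v)).
apply: anc_lt => // e; rewrite -e in y'y.
exact: (v_y' (btw_antisym vy' y'y)).
Qed.

(** If [x] is not an ancestor of [y], a point [a] between their meet [z] and [y]
    stands in for [x]: its descendants all lie in the component of [y] above [z]. *)
Lemma lt_interval x y : lt x y ->
  exists V, [/\ open V, V !=set0 & V `<=` [set v | lt x v /\ lt v y]].
Proof.
move=> /tree_ltP[[xy x_y]|[z [k [l [[Ik Il] kl Ck Cl Okl]]]]].
  have [V [oV V0 VS]] := interval_above_ancestor xy x_y.
  by exists V; split=> // v /VS[xv x_v vy]; split=> //; exact: anc_lt.
have [zy y_z] := enum_anc treeT enumC Il Cl.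
have [a [ba az a_y]] := midpoint treeT (nesym y_z).
have [ay za] := btw_transr zy ba.
have [V [oV V0 VS]] := interval_above_ancestor ay a_y.
exists V; split=> // v /VS[av a_v vy]; split=> //.
apply/tree_ltP; right; exists z, k, l; split=> //.
have Cla : C z l a.
  rewrite (enum_sideE treeT enumC Il Cl) /= => b.
  by apply: az; exact: btw_antisym (btwC ba) b.
rewrite (enum_sideE treeT enumC Il Cla) /= => b.
have [_ /btwC b'] := anc_trans za av.
by apply: az; exact: btw_antisym b' (btwC b).
Qed.

Lemma Mes_of_dense_before (mu : {finite_measure set (borel rho) -> \bar R}) :
  msupport mu = [set: T] -> Mes (tree_order rho I C O) mu.
Proof.
move=> supp x y /lt_interval[V [oV [v Vv] VS]].
have : msupport mu v by rewrite supp.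
move=> /(_ V oV Vv) /lt_le_trans; apply; apply: le_measure => //; rewrite inE.
  exact: measurable_open.
exact: measurable_interval.
Qed.

End given_orders.

End shuffled_order.

(** * The null event *)

Section almost_surely.
Context {R : realType} {T : metricType R} (treeT : @real_tree R T).
Variables (rho : T) (I : T -> set nat) (C : T -> nat -> set T).
Hypothesis enumC : component_enumeration rho I C.

(** Iterating the choice of a branch point between the current one and [y]
    produces a strictly increasing sequence, on which the distance to [rho]
    is increasing. *)
Lemma dense_branch_sequence x y :
  btw rho x y -> x <> y -> branching_dense rho x y ->
  exists p : nat -> T, injective p /\
    forall n, strictly_between rho x (p n) y /\ Br rho (p n).
Proof.
move=> xy x_y dxy.
pose above q := btw rho x q /\ btw rho q y /\ q <> y.
have step q : exists q', above q ->
    [/\ btw rho q q', q' <> q, above q' & Br rho q'].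
  have [[xq [qy q_y]]|] := pselect (above q); last by exists q.
  have [q' [qq' q'y q'q q'_y] Bq'] := dxy q y xq qy (btwyy _ _) q_y.
  exists q' => _; split=> //; split=> //.
  by have [] := anc_trans xq qq'.
have [g gP] := choice step.
pose p n := iter n.+1 g x.
have aboveI n : above (iter n g x).
  elim: n => [|n IH]; first by split; [exact: btwyy|].
  by have [] := gP _ IH.
have p_lt n : btw rho (p n) (p n.+1) /\ p n.+1 <> p n.
  by have [] := gP _ (aboveI n.+1).
have depth_lt m n : (m < n)%N -> mdist rho (p m) < mdist rho (p n).
  move: m n; apply: (@homo_ltn _ (fun n => mdist rho (p n)) (fun a b => a < b)).
    by move=> ? ? ?; exact: lt_trans.
  move=> k /=.
  have [b /eqP/negPf ne] := p_lt k; rewrite -b ltrDl mdist_gt0 eq_sym.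
  by rewrite ne.
exists p; split=> [m n e|n].
  by case: (ltngtP m n) => // /depth_lt; rewrite e ltxx.
have [xq [qy q_y]] := aboveI n.+1.
have [xpn pnx _ Bp] := gP _ (aboveI n).
split=> //; split=> // e.
have [xn _] := aboveI n.
apply: pnx; rewrite -[g _]/(p n) e; apply: btw_antisym xn _.
by rewrite -[X in btw _ _ X]e.
Qed.

Context {d : measure_display} {Omega : measurableType d}.
Context {P : probability Omega R} {U : T * nat -> {RV P >-> R}}.
Hypothesis iidU : iid_uniform01 (shuffle_index rho I) U.

(** At each branch point of an infinite sequence between [x] and [y], the
    variable of the component of [y] competes with that of another component;
    distinct branch points use distinct variables. *)
Lemma negligible_no_branch_before x y :
  btw rho x y -> x <> y -> branching_dense rho x y ->
  P.-negligible [set w | ~ branch_before_between rho I C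
    (fun z k l => U (z, k) w <= U (z, l) w) x y].
Proof.
move=> xy x_y /(dense_branch_sequence xy x_y)[p [p_inj pP]].
have kl n : exists kl : nat * nat,
    [/\ I (p n) kl.1, I (p n) kl.2, kl.1 <> kl.2 & C (p n) kl.1 y].
  have [[_ py _ p_y] Bp] := pP n.
  have [v [pv vp yv]] := Br_other treeT Bp py (nesym p_y).
  have [k Ik Ck] := enum_ex treeT enumC py (nesym p_y).
  have [l Il Cl] := enum_ex treeT enumC pv vp.
  exists (k, l); split=> //= kl; move: Cl.
  by rewrite -kl (enum_sideE treeT enumC Ik Ck).
have [f fP] := choice kl.
have neg := @negligible_never_le _ _ _ _ _ _ _ iidU
  (fun n => (p n, (f n).2)) (fun n => (p n, (f n).1)).
apply: negligibleS (neg _ _ _ _ _) => /=.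
- move=> w /= h n le; apply: h; have [Ik Il ne Ck] := fP n.
  by exists (p n), (f n).1, (f n).2; split=> //; case: (pP n).
- by move=> n; have [_ Bp] := pP n; split; [left|case: (fP n)].
- by move=> n; have [_ Bp] := pP n; split; [left|case: (fP n)].
- by move=> m n [/p_inj].
- by move=> m n [/p_inj].
- by move=> m n [/p_inj -> e]; case: (fP n) => _ _ /(_ (esym e)).
Qed.

End almost_surely.

Theorem proposition2p8 (R : realType) (T : metricType R) (rho : T)
    (treeT : @real_tree R T) (compactT : compact [set: T])
    (I : T -> set nat) (C : T -> nat -> set T)
    (enumC : component_enumeration rho I C)
    (d : measure_display) (Omega : measurableType d) (P : probability Omega R)
    (U : T * nat -> {RV P >-> R})
    (iidU : iid_uniform01 (shuffle_index rho I) U) :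
  {ae P, forall w, forall mu : {finite_measure set (borel rho) -> \bar R},
    msupport mu = [set: T] -> Mes (shuffle_order rho I C U w) mu}.
Proof.
pose D := [set e : T * T | (Br rho e.1 /\ Br rho e.2) /\
  [/\ btw rho e.1 e.2, e.1 <> e.2 & branching_dense rho e.1 e.2]].
have cBr : countable (Br rho) by exact: countable_Br.
have cD : countable D.
  by apply: sub_countable (countableX cBr cBr); apply: subset_card_le => e [].
pose bad (e : T * T) := [set w | ~ branch_before_between rho I C
  (fun z k l => U (z, k) w <= U (z, l) w) e.1 e.2].
apply: (negligibleS (A := \bigcup_(e in D) bad e)); last first.
  apply: negligible_countable_bigcup => // e [_ [xy x_y dxy]].
  exact: (negligible_no_branch_before treeT enumC iidU).
move=> w; apply: contra_notP => good mu.
apply: (Mes_of_dense_before treeT enumC) => x y Bx By xy x_y dxy.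
by apply: contrapT => nb; apply: good; exists (x, y).
Qed.
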